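(* Let $G$ be a computable subgroup of $S_\infty$. If the actions of $G$ are non-isolated, then $R^{ce}_G$ is $\Sigma^0_3$-universal, i.e., every $\Sigma^0_3$ equivalence relation on $\omega$ is computably reducible to $R^{ce}_G$.
   Context: $(W_e)_{e\in\omega}$ is a standard uniform enumeration of the c.e.\ subsets of $\omega$. A computable subgroup of $S_\infty$ is a computable group acting computably by permutations on $\omega$, with induced representation $\pi:G\to S_\omega$. For $Y\subseteq\omega$, $\mathrm{Stab}(Y)=\{g\in G:\forall x\in Y\ (g(x)=x)\}$; the actions of $G$ are isolated if there is a finite $F\subseteq\omega$ with $\mathrm{Stab}(F)=\ker(\pi)$, and non-isolated otherwise. $i\,R^{ce}_G\,j\iff(\exists\gamma\in G)(W_i=\{\gamma(x):x\in W_j\})$. $E$ is computably reducible to $F$ if there is a computable $f$ with $x\,E\,y\iff f(x)\,F\,f(y)$. *)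

(* Defs.v *)
From Stdlib Require Import Arith Lia List RelationClasses.
From Stdlib Require Cantor.

Definition cpair (x y : nat) : nat := Cantor.to_nat (x, y).

(* Codes for the unary partial recursive functions; functions of several
   arguments are handled through the Cantor pairing. *)
Inductive code : Set :=
| cZero : code
| cSucc : code
| cFst : code
| cSnd : code
| cPair : code -> code -> code
| cComp : code -> code -> code
| cPrec : code -> code -> code
| cMu : code -> code.

(* Graph of the function h defined by
   h(a, 0) = f(a) and h(a, n+1) = g(<a, <n, h(a, n)>>). *)
Fixpoint prec_graph (f g : nat -> nat -> Prop) (a n y : nat) : Prop :=
  match n with
  | 0 => f a y
  | S m => exists z, prec_graph f g a m z /\ g (cpair a (cpair m z)) y
  end.

(* [eval c x y] : the partial function coded by [c] converges on [x] with
   value [y]. *)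
Fixpoint eval (c : code) (x y : nat) : Prop :=
  match c with
  | cZero => y = 0
  | cSucc => y = S x
  | cFst => y = fst (Cantor.of_nat x)
  | cSnd => y = snd (Cantor.of_nat x)
  | cPair c1 c2 => exists u v, eval c1 x u /\ eval c2 x v /\ y = cpair u v
  | cComp c1 c2 => exists z, eval c2 x z /\ eval c1 z y
  | cPrec c1 c2 =>
      prec_graph (eval c1) (eval c2)
        (fst (Cantor.of_nat x)) (snd (Cantor.of_nat x)) y
  | cMu c1 =>
      eval c1 (cpair x y) 0 /\
      forall m, m < y -> exists k, eval c1 (cpair x m) (S k)
  end.

Fixpoint encode (c : code) : nat :=
  match c with
  | cZero => 0
  | cSucc => 1
  | cFst => 2
  | cSnd => 3
  | cPair c1 c2 => 4 + 4 * cpair (encode c1) (encode c2)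
  | cComp c1 c2 => 5 + 4 * cpair (encode c1) (encode c2)
  | cPrec c1 c2 => 6 + 4 * cpair (encode c1) (encode c2)
  | cMu c1 => 7 + 4 * encode c1
  end.

Definition phi (e x y : nat) : Prop := exists c, encode c = e /\ eval c x y.

(* W_e is the domain of phi_e. *)
Definition W (e x : nat) : Prop := exists y, phi e x y.

(* The next lemmas check that [encode] is a bijective Goedel numbering and that
   every phi_e is single-valued. *)

Lemma cpair_inj x y x' y' : cpair x y = cpair x' y' -> x = x' /\ y = y'.
Proof.
  unfold cpair; intros H.
  apply (f_equal Cantor.of_nat) in H.
  rewrite !Cantor.cancel_of_to in H; injection H; auto.
Qed.

Lemma encode_inj c d : encode c = encode d -> c = d.
Proof.
  revert d; induction c; destruct d; cbn [encode]; intros H;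
    try lia; try reflexivity;
    try (assert (E : cpair (encode c1) (encode c2) =
                     cpair (encode d1) (encode d2)) by lia;
         apply cpair_inj in E; destruct E; f_equal; auto).
  f_equal; apply IHc; lia.
Qed.

Lemma encode_surj e : exists c, encode c = e.
Proof.
  induction e as [e IH] using lt_wf_ind.
  destruct (lt_dec e 4) as [h|h].
  { destruct e as [|[|[|[|e]]]]; [exists cZero|exists cSucc|exists cFst|exists cSnd|lia];
      reflexivity. }
  pose (q := (e - 4) / 4); pose (r := (e - 4) mod 4).
  assert (Hq : e - 4 = 4 * q + r) by apply Nat.div_mod_eq.
  assert (Hr : r < 4) by (apply Nat.mod_upper_bound; lia).
  clearbody q r.
  destruct (IH q) as [c Hc]; [lia|].
  destruct (Cantor.of_nat q) as [a b] eqn:Eab.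
  assert (Hp : cpair a b = q) by (unfold cpair; rewrite <- Eab; apply Cantor.cancel_to_of).
  assert (Hle : b + a <= q) by (rewrite <- Hp; apply Cantor.to_nat_non_decreasing).
  destruct (IH a) as [ca Ha]; [lia|]; destruct (IH b) as [cb Hb]; [lia|].
  assert (Hr' : r = 0 \/ r = 1 \/ r = 2 \/ r = 3) by lia.
  destruct Hr' as [H|[H|[H|H]]]; subst r;
    [exists (cPair ca cb)|exists (cComp ca cb)|exists (cPrec ca cb)|exists (cMu c)];
    cbn [encode]; rewrite ?Ha, ?Hb, ?Hp, ?Hc; lia.
Qed.

Lemma eval_functional c x y y' : eval c x y -> eval c x y' -> y = y'.
Proof.
  revert x y y'; induction c; cbn [eval]; intros x y y' H H'; try congruence.
  - destruct H as (u & v & Hu & Hv & ->), H' as (u' & v' & Hu' & Hv' & ->).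
    f_equal; eauto.
  - destruct H as (z & Hz & Hy), H' as (z' & Hz' & Hy').
    rewrite (IHc2 _ _ _ Hz Hz') in Hy; eauto.
  - revert y y' H H'.
    generalize (fst (Cantor.of_nat x)) as a; generalize (snd (Cantor.of_nat x)) as n.
    induction n as [|n IH]; cbn [prec_graph]; intros a y y' H H'; eauto.
    destruct H as (z & Hz & Hy), H' as (z' & Hz' & Hy').
    rewrite (IH _ _ _ Hz Hz') in Hy; eauto.
  - destruct H as [H0 Hlt], H' as [H0' Hlt'].
    destruct (lt_eq_lt_dec y y') as [[h|h]|h]; auto; exfalso.
    + destruct (Hlt' _ h) as [k Hk]; discriminate (IHc _ _ _ H0 Hk).
    + destruct (Hlt _ h) as [k Hk]; discriminate (IHc _ _ _ H0' Hk).
Qed.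

Lemma phi_functional e x y y' : phi e x y -> phi e x y' -> y = y'.
Proof.
  intros (c & Hc & H) (c' & Hc' & H').
  assert (c = c') as <- by (apply encode_inj; congruence).
  eapply eval_functional; eauto.
Qed.

Definition computable (f : nat -> nat) : Prop :=
  exists c, forall x, eval c x (f x).

Definition computable2 (f : nat -> nat -> nat) : Prop :=
  computable (fun n => f (fst (Cantor.of_nat n)) (snd (Cantor.of_nat n))).

Definition computable_set (A : nat -> Prop) : Prop :=
  exists f, computable f /\
    forall x, (A x -> f x = 1) /\ (~ A x -> f x = 0).

Definition Sigma03 (E : nat -> nat -> Prop) : Prop :=
  exists A, computable_set A /\
    forall x y, E x y <->
      exists a, forall b, exists c, A (cpair (cpair x y) (cpair a (cpair b c))).

Definition computably_reducible (E F : nat -> nat -> Prop) : Prop :=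
  exists f, computable f /\ forall x y, E x y <-> F (f x) (f y).

Definition Sigma03_universal (R : nat -> nat -> Prop) : Prop :=
  forall E : nat -> nat -> Prop,
    Equivalence E -> Sigma03 E -> computably_reducible E R.

(* A group whose domain is a computable subset of omega.  [mul] is a total
   computable function whose values outside the domain are irrelevant;
   computability of the inverse follows by search. *)
Record computable_group : Type := {
  dom : nat -> Prop;
  mul : nat -> nat -> nat;
  one : nat;
  dom_computable : computable_set dom;
  mul_computable : computable2 mul;
  one_dom : dom one;
  mul_dom : forall g h, dom g -> dom h -> dom (mul g h);
  mul_assoc : forall g h k, dom g -> dom h -> dom k ->
    mul g (mul h k) = mul (mul g h) k;
  mul_one_l : forall g, dom g -> mul one g = g;
  mul_one_r : forall g, dom g -> mul g one = g;
  mul_inv : forall g, dom g ->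
    exists h, dom h /\ mul h g = one /\ mul g h = one
}.

(* The action need not be faithful.  Each group element acts as a permutation
   of omega by the action laws. *)
Record computable_subgroup_Sinf : Type := {
  grp :> computable_group;
  act : nat -> nat -> nat;
  act_computable : computable2 act;
  act_one : forall x, act (one grp) x = x;
  act_mul : forall g h x, dom grp g -> dom grp h ->
    act (mul grp g h) x = act g (act h x)
}.

Definition Stab (G : computable_subgroup_Sinf) (Y : nat -> Prop) (g : nat) : Prop :=
  dom G g /\ forall x, Y x -> act G g x = x.

Definition ker (G : computable_subgroup_Sinf) (g : nat) : Prop :=
  dom G g /\ forall x, act G g x = x.

Definition isolated (G : computable_subgroup_Sinf) : Prop :=
  exists F : list nat, forall g, Stab G (fun x => In x F) g <-> ker G g.

Definition non_isolated (G : computable_subgroup_Sinf) : Prop := ~ isolated G.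

Definition Rce (G : computable_subgroup_Sinf) (i j : nat) : Prop :=
  exists g, dom G g /\
    forall y, W i y <-> exists x, W j x /\ y = act G g x.

(* Main.v *)
From Stdlib Require Import Arith Lia List Bool RelationClasses ClassicalEpsilon.
From Stdlib Require Cantor.
Require Import Defs.
Import ListNotations.

(** Write the relation as [x E y <-> exists i, forall b, exists c, A(x,y,i,b,c)].  For a set
    [S] of numbers below [n], say that [S] is crossed to depth [k] when [A] relates, via some
    [i < n] and for all [b < k], two numbers below [n] separated by [S].  If [x E y], every [S]
    with [n] large that separates [x] and [y] is crossed to all depths; otherwise the
    [E]-class of [x] below [n] is a set that separates them and is crossed only to a bounded
    depth.  Giving each triple [t = (n, S, k)] the bit [x in S], and calling it live when [k]
    is the exact depth to which [S] is crossed (a limit-computable condition), we get: [x E y]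
    iff the bits of [x] and [y] differ at only finitely many live [t].

    Non-isolation supplies group elements [h_t] fixing larger and larger finite sets, and
    [V_x] is the image of a set [C] under the infinite product of the [h_t] over the live [t]
    whose bit at [x] is 1.  A finite difference of bits only changes a finite initial factor of
    the product, hence moves [V_x] by an element of [G].  Each [h_t] and a finite part of [C]
    are chosen so that [h_t C <> u^-1 g v C] for all [g <= t] and all partial products [u, v] of
    the earlier elements, so an infinite difference defeats every [g] in [G].  The construction
    is a finite-injury one: when the guess about some [t] changes, the later factors are
    discarded and [C] is replaced by the union of its images under all their partial
    products, which keeps every [V_x] increasing. *)

(** * Computability of functions on encoded types *)

(** The encoding is the identity on numbers and [cpair] on pairs of numbers, so on [nat] the
    predicate [Comp] below is [computable] by conversion. *)
Class Enc (A : Type) := enc : A -> nat.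
#[export] Instance enc_nat : Enc nat := fun n => n.
#[export] Instance enc_bool : Enc bool := Nat.b2n.
#[export] Instance enc_prod {A B} `{Enc A} `{Enc B} : Enc (A * B) :=
  fun p => cpair (enc (fst p)) (enc (snd p)).
#[export] Instance enc_list {A} `{Enc A} : Enc (list A) :=
  fix enc_list l := match l with
                    | [] => 0
                    | x :: l' => S (cpair (enc x) (enc_list l'))
                    end.

(* The code may diverge on numbers that encode no element of [A]. *)
Definition Comp {A B} `{Enc A} `{Enc B} (f : A -> B) : Prop :=
  exists c, forall a, eval c (enc a) (enc (f a)).

Lemma of_nat_cpair x y : Cantor.of_nat (cpair x y) = (x, y).
Proof. apply Cantor.cancel_of_to. Qed.

Lemma cpair_ge x y : x <= cpair x y /\ y <= cpair x y.
Proof. pose proof (Cantor.to_nat_non_decreasing x y); unfold cpair; lia. Qed.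

Lemma eval_fst x y : eval cFst (cpair x y) x.
Proof. simpl; now rewrite of_nat_cpair. Qed.

Lemma eval_snd x y : eval cSnd (cpair x y) y.
Proof. simpl; now rewrite of_nat_cpair. Qed.

Lemma eval_comp c d x y z : eval d x y -> eval c y z -> eval (cComp c d) x z.
Proof. intros; simpl; eauto. Qed.

Lemma eval_pair c d x y z : eval c x y -> eval d x z -> eval (cPair c d) x (cpair y z).
Proof. intros; simpl; eauto 6. Qed.

Definition cId : code := cPair cFst cSnd.

Lemma eval_id x : eval cId x x.
Proof.
  exists (fst (Cantor.of_nat x)), (snd (Cantor.of_nat x)).
  repeat split; unfold cpair.
  rewrite <- surjective_pairing; symmetry; apply Cantor.cancel_to_of.
Qed.

Fixpoint cConst (n : nat) : code :=
  match n with 0 => cZero | S m => cComp cSucc (cConst m) end.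

Lemma eval_const n x : eval (cConst n) x n.
Proof. induction n as [|n IH]; [reflexivity|]; simpl; eauto. Qed.

Lemma eval_prec c1 c2 a n (h : nat -> nat) :
  eval c1 a (h 0) ->
  (forall m, m < n -> eval c2 (cpair a (cpair m (h m))) (h (S m))) ->
  eval (cPrec c1 c2) (cpair a n) (h n).
Proof.
  intros H0 HS; cbn [eval]; rewrite of_nat_cpair; cbn [fst snd].
  induction n as [|n IH]; cbn [prec_graph]; [assumption|].
  exists (h n); split; [apply IH; auto|apply HS; lia].
Qed.

Definition cSg : code := cComp (cPrec cZero (cConst 1)) (cPair cZero cId).

Lemma eval_sg n : eval cSg n (match n with 0 => 0 | S _ => 1 end).
Proof.
  eapply eval_comp; [eapply eval_pair; [reflexivity|apply eval_id]|].
  apply (eval_prec _ _ _ n (fun n => match n with 0 => 0 | S _ => 1 end)); [reflexivity|].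
  intros; apply eval_const.
Qed.

(* Recursing over the sign of [n] evaluates [c2] only when [n] is positive. *)
Definition cCase (cn c1 c2 : code) : code :=
  cComp (cPrec c1 (cComp c2 cFst)) (cPair cId (cComp cSg cn)).

(** The recursion starts from [c1] whatever the sign, so [c1] must converge even where its value is
    discarded. *)
Lemma eval_case cn c1 c2 a n y :
  eval cn a n ->
  (n = 0 -> eval c1 a y) ->
  (n <> 0 -> eval c2 a y /\ exists z, eval c1 a z) ->
  eval (cCase cn c1 c2) a y.
Proof.
  intros Hn H1 H2.
  eapply eval_comp.
  { eapply eval_pair; [apply eval_id|eapply eval_comp; [exact Hn|apply eval_sg]]. }
  destruct n as [|n].
  - apply (eval_prec _ _ a 0 (fun _ => y)); [auto|lia].
  - destruct H2 as [H2 [z Hz]]; [lia|].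
    apply (eval_prec _ _ a 1 (fun n => match n with 0 => z | S _ => y end)); [auto|].
    intros m Hm; eapply eval_comp; [apply eval_fst|].
    replace m with 0 by lia; assumption.
Qed.

(** * Closure of computable functions under the basic constructions *)

Section Closure.
Context {Γ : Type} `{Enc Γ}.

Lemma Comp_ext {B} `{Enc B} (f g : Γ -> B) : (forall a, f a = g a) -> Comp f -> Comp g.
Proof. intros E [c Hc]; exists c; intros a; rewrite <- E; auto. Qed.

Lemma Comp_id : Comp (fun a : Γ => a).
Proof. exists cId; intros; apply eval_id. Qed.

Lemma Comp_const {B} `{Enc B} (b : B) : Comp (fun _ : Γ => b).
Proof. exists (cConst (enc b)); intros; apply eval_const. Qed.

Lemma Comp_comp {B C} `{Enc B} `{Enc C} (g : B -> C) (f : Γ -> B) :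
  Comp g -> Comp f -> Comp (fun a => g (f a)).
Proof.
  intros [d Hd] [c Hc]; exists (cComp d c); intros a.
  eapply eval_comp; eauto.
Qed.

Lemma Comp_pair {B C} `{Enc B} `{Enc C} (f : Γ -> B) (g : Γ -> C) :
  Comp f -> Comp g -> Comp (fun a => (f a, g a)).
Proof.
  intros [c Hc] [d Hd]; exists (cPair c d); intros a; apply eval_pair; auto.
Qed.

Lemma Comp_fst {B C} `{Enc B} `{Enc C} (f : Γ -> B * C) : Comp f -> Comp (fun a => fst (f a)).
Proof.
  intros [c Hc]; exists (cComp cFst c); intros a.
  eapply eval_comp; [apply Hc|apply eval_fst].
Qed.

Lemma Comp_snd {B C} `{Enc B} `{Enc C} (f : Γ -> B * C) : Comp f -> Comp (fun a => snd (f a)).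
Proof.
  intros [c Hc]; exists (cComp cSnd c); intros a.
  eapply eval_comp; [apply Hc|apply eval_snd].
Qed.

Lemma Comp_app2 {A B C} `{Enc A} `{Enc B} `{Enc C} (g : A -> B -> C) (f1 : Γ -> A) (f2 : Γ -> B) :
  Comp (fun p : A * B => g (fst p) (snd p)) ->
  Comp f1 -> Comp f2 -> Comp (fun a => g (f1 a) (f2 a)).
Proof.
  intros Hg H1' H2'.
  exact (Comp_comp (fun p => g (fst p) (snd p)) (fun a => (f1 a, f2 a)) Hg (Comp_pair _ _ H1' H2')).
Qed.

Lemma Comp_cpair (f g : Γ -> nat) : Comp f -> Comp g -> Comp (fun a => cpair (f a) (g a)).
Proof. exact (Comp_pair f g). Qed.

(** A number and the pair it decodes to have the same [enc], so the code for [f] serves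
    unchanged. *)
Lemma Comp_unpair (f : Γ -> nat) : Comp f -> Comp (fun a => Cantor.of_nat (f a)).
Proof.
  intros [c Hc]; exists c; intros a.
  replace (enc (Cantor.of_nat (f a))) with (f a); [apply Hc|].
  transitivity (Cantor.to_nat (Cantor.of_nat (f a))); [symmetry; apply Cantor.cancel_to_of|].
  destruct (Cantor.of_nat (f a)); reflexivity.
Qed.

Lemma Comp_S (f : Γ -> nat) : Comp f -> Comp (fun a => S (f a)).
Proof.
  intros [c Hc]; exists (cComp cSucc c); intros a.
  eapply eval_comp; [apply Hc|reflexivity].
Qed.

Lemma Comp_natrec {B} `{Enc B} (n : Γ -> nat) (i : Γ -> B) (f : Γ -> nat -> B -> B) :
  Comp n -> Comp i ->
  Comp (fun p : Γ * (nat * B) => f (fst p) (fst (snd p)) (snd (snd p))) ->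
  Comp (fun a => nat_rect (fun _ => B) (i a) (f a) (n a)).
Proof.
  intros [cn Hn] [ci Hi] [cf Hf].
  exists (cComp (cPrec ci cf) (cPair cId cn)); intros a.
  eapply eval_comp; [eapply eval_pair; [apply eval_id|apply Hn]|].
  apply (eval_prec _ _ _ _ (fun m => enc (nat_rect (fun _ => B) (i a) (f a) m))); [apply Hi|].
  intros m _; exact (Hf (a, (m, nat_rect (fun _ => B) (i a) (f a) m))).
Qed.

Lemma Comp_if {B} `{Enc B} (b : Γ -> bool) (f g : Γ -> B) :
  Comp b -> Comp f -> Comp g -> Comp (fun a => if b a then f a else g a).
Proof.
  intros [cb Hb] [cf Hf] [cg Hg]; exists (cCase cb cg cf); intros a.
  eapply eval_case; [apply Hb|..]; destruct (b a); cbn; try lia; eauto.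
Qed.

Lemma Comp_cons {B} `{Enc B} (f : Γ -> B) (l : Γ -> list B) :
  Comp f -> Comp l -> Comp (fun a => f a :: l a).
Proof.
  intros Hf Hl; destruct (Comp_pair _ _ Hf Hl) as [c Hc].
  exists (cComp cSucc c); intros a; eapply eval_comp; [apply Hc|reflexivity].
Qed.

Lemma Comp_pred (f : Γ -> nat) : Comp f -> Comp (fun a => pred (f a)).
Proof.
  intros Hf.
  apply (Comp_ext (fun a => nat_rect (fun _ => nat) 0 (fun n _ => n) (f a))).
  { intros a; destruct (f a); reflexivity. }
  apply (Comp_natrec f (fun _ => 0) (fun _ n _ => n) Hf (Comp_const 0)).
  exists (cComp cFst cSnd); intros [a [n m]].
  eapply eval_comp; [apply eval_snd|apply eval_fst].
Qed.
End Closure.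

(** The predecessor of the code of a nonempty list codes its head and tail. [cCase] keeps the code
    for [g] from being run on an empty list, where it may diverge. *)
Lemma Comp_list_case {Γ A B} `{Enc Γ} `{Enc A} `{Enc B}
    (l : Γ -> list A) (f : Γ -> B) (g : Γ -> A -> list A -> B) :
  Comp l -> Comp f ->
  Comp (fun p : Γ * (A * list A) => g (fst p) (fst (snd p)) (snd (snd p))) ->
  Comp (fun a => match l a with [] => f a | x :: t => g a x t end).
Proof.
  intros [cl Hl] [cf Hf] [cg Hg].
  destruct (Comp_pred (fun n : nat => n) Comp_id) as [cp Hp].
  exists (cCase cl cf (cComp cg (cPair cId (cComp cp cl)))); intros a.
  eapply eval_case; [apply Hl|..]; intros E.
  - destruct (l a); [apply Hf|discriminate].
  - split; [|eauto].
    eapply eval_comp; [eapply eval_pair; [apply eval_id|eapply eval_comp; [apply Hl|apply Hp]]|].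
    destruct (l a) as [|x t]; [contradiction E; reflexivity|].
    exact (Hg (a, (x, t))).
Qed.

(* One rule per head symbol of the body; bound variables of recursors
   reappear as projections of a context pair. *)
Ltac comp_more := fail.
Ltac comp1 :=
  cbv beta;
  lazymatch goal with
  | |- Comp (fun _ => ?c) => apply (Comp_const c)
  | |- Comp (fun x => x) => apply Comp_id
  | |- Comp fst => apply (Comp_fst (fun x => x))
  | |- Comp snd => apply (Comp_snd (fun x => x))
  | |- Comp (fun x => (@?f x, @?g x)) => apply (Comp_pair f g)
  | |- Comp (fun x => fst (@?f x)) => apply (Comp_fst f)
  | |- Comp (fun x => snd (@?f x)) => apply (Comp_snd f)
  | |- Comp (fun x => S (@?f x)) => apply (Comp_S f)
  | |- Comp (fun x => pred (@?f x)) => apply (Comp_pred f)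
  | |- Comp (fun x => cpair (@?f x) (@?g x)) => apply (Comp_cpair f g)
  | |- Comp (fun x => Cantor.of_nat (@?f x)) => apply (Comp_unpair f)
  | |- Comp (fun x => @?f x :: @?g x) => apply (Comp_cons f g)
  | |- Comp (fun x => if @?b x then @?f x else @?g x) => apply (Comp_if b f g)
  | |- Comp (fun x => nat_rect _ (@?i x) (@?f x) (@?n x)) => apply (Comp_natrec n i f)
  | |- Comp (fun x => match @?l x with [] => @?f x | y :: t => @?g x y t end) =>
      apply (Comp_list_case l f g)
  | C : Comp (fun p => ?g (fst p) (snd p)) |- Comp (fun x => ?g (@?f x) (@?h x)) =>
      apply (Comp_app2 g f h C)
  | C : Comp ?g |- Comp (fun x => ?g (@?f x)) => apply (Comp_comp g f C)
  | |- Comp _ => first [assumption | comp_more]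
  end.
Ltac comp := repeat comp1.

(** * Computable operations on lists, Booleans and numbers *)

Lemma enc_list_length {A} `{Enc A} (l : list A) : length l <= enc l.
Proof.
  induction l as [|x l IH]; [reflexivity|].
  change (enc (x :: l)) with (S (cpair (enc x) (enc l))).
  pose proof (cpair_ge (enc x) (enc l)); simpl; lia.
Qed.

(** The pair holds the remaining list and the accumulator. The step is idle on an empty list, so
    surplus iterations are harmless. *)
Definition fold_step {A B} (f : B -> A -> B) (p : list A * B) : list A * B :=
  match fst p with [] => p | x :: t => (t, f (snd p) x) end.

Lemma fold_step_iter {A B} (f : B -> A -> B) n l b :
  length l <= n ->
  nat_rect (fun _ => (list A * B)%type) (l, b) (fun _ => fold_step f) n = ([], fold_left f l b).
Proof.
  intros Hn.
  assert (E : forall n p, nat_rect (fun _ => (list A * B)%type) (fold_step f p) (fun _ => fold_step f) n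
                     = fold_step f (nat_rect (fun _ => (list A * B)%type) p (fun _ => fold_step f) n)).
  { clear; intros n p; induction n as [|n IH]; simpl; [reflexivity|now rewrite IH]. }
  revert l b Hn; induction n as [|n IH]; intros [|x l] b Hn; simpl in *; try lia; auto.
  - rewrite IH; simpl; [reflexivity|lia].
  - rewrite <- E; apply IH; lia.
Qed.

Section Lists.
Context {Γ A B : Type} `{Enc Γ} `{Enc A} `{Enc B}.

(** The code of a list bounds its length and so serves as the number of iterations. *)
Lemma Comp_fold_left (f : Γ -> B -> A -> B) (l : Γ -> list A) (i : Γ -> B) :
  Comp l -> Comp i ->
  Comp (fun p : Γ * (B * A) => f (fst p) (fst (snd p)) (snd (snd p))) ->
  Comp (fun a => fold_left (f a) (l a) (i a)).
Proof.
  intros Hl Hi Hf.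
  apply (Comp_ext (fun a => snd (nat_rect (fun _ => (list A * B)%type) (l a, i a)
                                   (fun _ => fold_step (f a)) (enc (l a))))).
  { intros a; rewrite fold_step_iter; [reflexivity|apply enc_list_length]. }
  unfold fold_step; comp.
  exact (Comp_comp (fun p : Γ * (B * A) => f (fst p) (fst (snd p)) (snd (snd p)))
             (fun p : Γ * (nat * (list A * B)) * (A * list A) =>
                (fst (fst p), (snd (snd (snd (fst p))), fst (snd p)))) Hf ltac:(comp)).
Qed.

End Lists.

Lemma Comp_rev {Γ A} `{Enc Γ} `{Enc A} (l : Γ -> list A) : Comp l -> Comp (fun a => rev (l a)).
Proof.
  intros Hl.
  apply (Comp_ext (fun a => fold_left (fun r x => x :: r) (l a) [])).
  { intros a; rewrite <- (fold_left_rev_right cons).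
    induction (rev (l a)) as [|x r IH]; simpl; congruence. }
  apply (Comp_fold_left (fun _ r x => x :: r)); comp.
Qed.

Lemma Comp_fold_right {Γ A B} `{Enc Γ} `{Enc A} `{Enc B}
    (f : Γ -> A -> B -> B) (l : Γ -> list A) (i : Γ -> B) :
  Comp l -> Comp i ->
  Comp (fun p : Γ * (A * B) => f (fst p) (fst (snd p)) (snd (snd p))) ->
  Comp (fun a => fold_right (f a) (i a) (l a)).
Proof.
  intros Hl Hi Hf.
  apply (Comp_ext (fun a => fold_left (fun b x => f a x b) (rev (l a)) (i a))).
  { intros a; now rewrite <- (fold_left_rev_right (f a)), rev_involutive. }
  apply (Comp_fold_left (fun a b x => f a x b)); [now apply Comp_rev|assumption|].
  exact (Comp_comp (fun p : Γ * (A * B) => f (fst p) (fst (snd p)) (snd (snd p)))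
           (fun p : Γ * (B * A) => (fst p, (snd (snd p), fst (snd p)))) Hf ltac:(comp)).
Qed.

Ltac comp_more ::=
  lazymatch goal with
  | |- Comp (fun x => fold_right (@?f x) (@?i x) (@?l x)) => apply (Comp_fold_right f l i)
  | |- Comp (fun x => fold_left (@?f x) (@?l x) (@?i x)) => apply (Comp_fold_left f l i)
  end.

Section MoreLists.
Context {Γ A B : Type} `{Enc Γ} `{Enc A} `{Enc B}.

Lemma Comp_app (k l : Γ -> list A) : Comp k -> Comp l -> Comp (fun a => k a ++ l a).
Proof.
  intros.
  apply (Comp_ext (fun a => fold_right cons (l a) (k a))).
  { intros a; induction (k a); simpl; congruence. }
  comp.
Qed.

Lemma Comp_map (f : Γ -> A -> B) (l : Γ -> list A) :
  Comp l -> Comp (fun p : Γ * A => f (fst p) (snd p)) -> Comp (fun a => map (f a) (l a)).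
Proof.
  intros Hl Hf.
  apply (Comp_ext (fun a => fold_right (fun x r => f a x :: r) [] (l a))).
  { intros a; induction (l a); simpl; congruence. }
  comp.
Qed.

Lemma Comp_existsb (f : Γ -> A -> bool) (l : Γ -> list A) :
  Comp l -> Comp (fun p : Γ * A => f (fst p) (snd p)) -> Comp (fun a => existsb (f a) (l a)).
Proof.
  intros Hl Hf.
  apply (Comp_ext (fun a => fold_right (fun x r => if f a x then true else r) false (l a))).
  { intros a; induction (l a) as [|x r IH]; simpl; [reflexivity|].
    rewrite IH; destruct (f a x); reflexivity. }
  comp.
Qed.

Lemma Comp_forallb (f : Γ -> A -> bool) (l : Γ -> list A) :
  Comp l -> Comp (fun p : Γ * A => f (fst p) (snd p)) -> Comp (fun a => forallb (f a) (l a)).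
Proof.
  intros Hl Hf.
  apply (Comp_ext (fun a => fold_right (fun x r => if f a x then r else false) true (l a))).
  { intros a; induction (l a) as [|x r IH]; simpl; [reflexivity|].
    rewrite IH; destruct (f a x); reflexivity. }
  comp.
Qed.

Lemma Comp_length (l : Γ -> list A) : Comp l -> Comp (fun a => length (l a)).
Proof.
  intros.
  apply (Comp_ext (fun a => fold_right (fun _ n => S n) 0 (l a))).
  { intros a; induction (l a); simpl; congruence. }
  comp.
Qed.

Lemma Comp_nth (n : Γ -> nat) (l : Γ -> list A) (d : A) :
  Comp n -> Comp l -> Comp (fun a => nth (n a) (l a) d).
Proof.
  intros.
  apply (Comp_ext (fun a => match nat_rect (fun _ => list A) (l a)
                              (fun _ r => match r with [] => [] | _ :: t => t end) (n a) with
                            | [] => d | x :: _ => x end)).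
  { intros a.
    assert (E : forall m, nat_rect (fun _ => list A) (l a)
                  (fun _ r => match r with [] => [] | _ :: t => t end) m = skipn m (l a)).
    { induction m as [|m IH]; cbn [nat_rect]; [reflexivity|]; rewrite IH.
      change (S m) with (1 + m); rewrite <- skipn_skipn.
      destruct (skipn m (l a)); reflexivity. }
    rewrite E; clear E; generalize (l a); induction (n a); intros [|x r]; simpl; auto. }
  comp.
Qed.

Lemma Comp_negb (f : Γ -> bool) : Comp f -> Comp (fun a => negb (f a)).
Proof. intros; unfold negb; comp. Qed.

Lemma Comp_andb (f g : Γ -> bool) : Comp f -> Comp g -> Comp (fun a => f a && g a).
Proof. intros; unfold andb; comp. Qed.

Lemma Comp_orb (f g : Γ -> bool) : Comp f -> Comp g -> Comp (fun a => f a || g a).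
Proof. intros; unfold orb; comp. Qed.

Lemma Comp_xorb (f g : Γ -> bool) : Comp f -> Comp g -> Comp (fun a => xorb (f a) (g a)).
Proof. intros; unfold xorb; comp. Qed.

Lemma Comp_eqbool (f g : Γ -> bool) : Comp f -> Comp g -> Comp (fun a => Bool.eqb (f a) (g a)).
Proof. intros; unfold Bool.eqb; comp. Qed.

Lemma Comp_add (f g : Γ -> nat) : Comp f -> Comp g -> Comp (fun a => f a + g a).
Proof.
  intros.
  apply (Comp_ext (fun a => nat_rect (fun _ => nat) (g a) (fun _ => S) (f a))).
  { intros a; induction (f a); simpl; congruence. }
  comp.
Qed.

Lemma Comp_sub (f g : Γ -> nat) : Comp f -> Comp g -> Comp (fun a => f a - g a).
Proof.
  intros.
  apply (Comp_ext (fun a => nat_rect (fun _ => nat) (f a) (fun _ => pred) (g a))).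
  { intros a; induction (g a); simpl; lia. }
  comp.
Qed.

Lemma Comp_eqb (f g : Γ -> nat) : Comp f -> Comp g -> Comp (fun a => f a =? g a).
Proof.
  intros Hf Hg.
  apply (Comp_ext (fun a => nat_rect (fun _ => bool) true (fun _ _ => false)
                              ((f a - g a) + (g a - f a)))).
  { intros a; destruct (Nat.eqb_spec (f a) (g a)) as [->|E].
    - now rewrite Nat.sub_diag.
    - destruct ((f a - g a) + (g a - f a)) eqn:E'; [lia|reflexivity]. }
  apply (Comp_natrec _ (fun _ => true) (fun _ _ _ => false)); comp.
  apply Comp_add; now apply Comp_sub.
Qed.

End MoreLists.

Lemma Comp_flat_map {Γ A B} `{Enc Γ} `{Enc A} `{Enc B}
    (f : Γ -> A -> list B) (l : Γ -> list A) :
  Comp l -> Comp (fun p : Γ * A => f (fst p) (snd p)) -> Comp (fun a => flat_map (f a) (l a)).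
Proof.
  intros Hl Hf.
  apply (Comp_ext (fun a => fold_right (fun x r => f a x ++ r) [] (l a))).
  { intros a; induction (l a); simpl; congruence. }
  comp; apply Comp_app; comp.
Qed.

Definition mem (x : nat) (l : list nat) : bool := existsb (Nat.eqb x) l.

Lemma mem_In x l : mem x l = true <-> In x l.
Proof.
  unfold mem; rewrite existsb_exists; split.
  - intros (y & Hy & E); apply Nat.eqb_eq in E; congruence.
  - intros Hx; exists x; now rewrite Nat.eqb_refl.
Qed.

Lemma Comp_mem {Γ} `{Enc Γ} (f : Γ -> nat) (l : Γ -> list nat) :
  Comp f -> Comp l -> Comp (fun a => mem (f a) (l a)).
Proof.
  intros Hf Hl; unfold mem.
  apply (Comp_existsb (fun a y => f a =? y)); [assumption|].
  apply Comp_eqb; comp.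
Qed.

Lemma Comp_seq {Γ} `{Enc Γ} (n : Γ -> nat) : Comp n -> Comp (fun a => seq 0 (n a)).
Proof.
  intros.
  apply (Comp_ext (fun a => nat_rect (fun _ => list nat) [] (fun n r => r ++ [n]) (n a))).
  { intros a; induction (n a) as [|m IH]; [reflexivity|].
    rewrite seq_S; simpl; congruence. }
  comp; apply Comp_app; comp.
Qed.

Ltac comp_more ::=
  lazymatch goal with
  | |- Comp (fun x => fold_right (@?f x) (@?i x) (@?l x)) => apply (Comp_fold_right f l i)
  | |- Comp (fun x => fold_left (@?f x) (@?l x) (@?i x)) => apply (Comp_fold_left f l i)
  | |- Comp (fun x => @?k x ++ @?l x) => apply (Comp_app k l)
  | |- Comp (fun x => map (@?f x) (@?l x)) => apply (Comp_map f l)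
  | |- Comp (fun x => flat_map (@?f x) (@?l x)) => apply (Comp_flat_map f l)
  | |- Comp (fun x => existsb (@?f x) (@?l x)) => apply (Comp_existsb f l)
  | |- Comp (fun x => forallb (@?f x) (@?l x)) => apply (Comp_forallb f l)
  | |- Comp (fun x => length (@?l x)) => apply (Comp_length l)
  | |- Comp (fun x => nth (@?n x) (@?l x) ?d) => apply (Comp_nth n l d)
  | |- Comp (fun x => negb (@?f x)) => apply (Comp_negb f)
  | |- Comp (fun x => @?f x && @?g x) => apply (Comp_andb f g)
  | |- Comp (fun x => @?f x || @?g x) => apply (Comp_orb f g)
  | |- Comp (fun x => xorb (@?f x) (@?g x)) => apply (Comp_xorb f g)
  | |- Comp (fun x => Bool.eqb (@?f x) (@?g x)) => apply (Comp_eqbool f g)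
  | |- Comp (fun x => @?f x + @?g x) => apply (Comp_add f g)
  | |- Comp (fun x => @?f x =? @?g x) => apply (Comp_eqb f g)
  | |- Comp (fun x => mem (@?f x) (@?g x)) => apply (Comp_mem f g)
  | |- Comp (fun x => seq 0 (@?f x)) => apply (Comp_seq f)
  end.

(** * Unbounded search and indices of c.e. sets *)

Lemma Comp_search {Γ} `{Enc Γ} (P : Γ -> nat -> bool) :
  Comp (fun p => P (fst p) (snd p)) -> (forall a, exists n, P a n = true) ->
  exists m : Γ -> nat, Comp m /\ forall a, P a (m a) = true.
Proof.
  intros HP Hex.
  (* Minimisation stops at the value 0, which is the code of [false]; hence the negation. *)
  assert (HN : Comp (fun p : Γ * nat => negb (P (fst p) (snd p)))) by comp.
  destruct HN as [c Hc].
  assert (Hm : forall a, exists n, eval (cMu c) (enc a) n /\ P a n = true).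
  { intros a.
    destruct (dec_inh_nat_subset_has_unique_least_element (fun n => P a n = true))
      as (n & [Hn Hl] & _); [intros n; destruct (P a n); auto|apply Hex|].
    exists n; split; [|assumption]; split.
    - generalize (Hc (a, n)); cbn; rewrite Hn; auto.
    - intros m Hm; exists 0; generalize (Hc (a, m)); cbn.
      destruct (P a m) eqn:E; [apply Hl in E; lia|auto]. }
  exists (fun a => proj1_sig (constructive_indefinite_description _ (Hm a))); split.
  - exists (cMu c); intros a.
    destruct (constructive_indefinite_description _ (Hm a)) as [n [Hn Hp]]; exact Hn.
  - intros a; destruct (constructive_indefinite_description _ (Hm a)) as [n [Hn Hp]]; exact Hp.
Qed.

(** Each successor composes with [cSucc], whose number is 1. The factor 4 of [encode] is unfolded
    into sums, so that the rule for addition applies. *)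
Lemma Comp_encode_const : Comp (fun n => encode (cConst n)).
Proof.
  apply (Comp_ext (fun n => nat_rect (fun _ => nat) 0 (fun _ e =>
    5 + (cpair 1 e + (cpair 1 e + (cpair 1 e + cpair 1 e)))) n)).
  { intros n; induction n as [|n IH]; [reflexivity|].
    cbn [nat_rect cConst encode]; rewrite IH; lia. }
  comp.
Qed.

(* The s-m-n theorem for domains, with the parameter hard-wired as a constant code. *)
Lemma ce_index (P : nat -> nat -> nat -> bool) :
  Comp (fun p : nat * nat * nat => P (fst (fst p)) (snd (fst p)) (snd p)) ->
  exists f, computable f /\ forall x y, W (f x) y <-> exists s, P x y s = true.
Proof.
  intros HP.
  assert (HN : Comp (fun p : nat * nat * nat => negb (P (fst (fst p)) (snd (fst p)) (snd p))))
    by (apply Comp_negb, HP).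
  destruct HN as [c Hc].
  pose (d x := cComp (cMu c) (cPair (cConst x) cId)).
  exists (fun x => encode (d x)); split.
  - enough (Comp (fun x => encode (d x))) by assumption.
    pose proof Comp_encode_const as He.
    apply (Comp_ext (fun x =>
      let p := cpair (encode (cMu c)) (4 + (cpair (encode (cConst x)) (encode cId)
        + (cpair (encode (cConst x)) (encode cId) + (cpair (encode (cConst x)) (encode cId)
        + cpair (encode (cConst x)) (encode cId)))))
      in 5 + (p + (p + (p + p))))).
    { intros x; cbv zeta; unfold d.
      change (encode (cComp (cMu c) (cPair (cConst x) cId))) with
        (5 + 4 * cpair (encode (cMu c)) (4 + 4 * cpair (encode (cConst x)) (encode cId))).
      replace (cpair (encode (cConst x)) (encode cId) + (cpair (encode (cConst x)) (encode cId)
        + (cpair (encode (cConst x)) (encode cId) + cpair (encode (cConst x)) (encode cId))))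
        with (4 * cpair (encode (cConst x)) (encode cId)) by lia.
      lia. }
    cbv zeta; generalize (encode (cMu c)) (encode cId); intros; comp.
  - intros x y.
    assert (Hin : eval (cPair (cConst x) cId) y (cpair x y))
      by (apply eval_pair; [apply eval_const|apply eval_id]).
    split.
    + intros (s & e & He & Hs).
      apply encode_inj in He; subst e.
      destruct Hs as (z & Hz & Hs & _).
      rewrite (eval_functional _ _ _ _ Hz Hin) in Hs.
      exists s; generalize (eval_functional _ _ _ _ Hs (Hc (x, y, s))); cbn.
      destruct (P x y s); [reflexivity|discriminate].
    + intros Hex.
      destruct (dec_inh_nat_subset_has_unique_least_element (fun s => P x y s = true))
        as (s & [Hs Hl] & _); [intros s; destruct (P x y s); auto|assumption|].
      exists s, (d x); split; [reflexivity|].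
      exists (cpair x y); split; [assumption|]; split.
      * generalize (Hc (x, y, s)); cbn; rewrite Hs; auto.
      * intros m Hm; exists 0; generalize (Hc (x, y, m)); cbn.
        destruct (P x y m) eqn:E; [apply Hl in E; lia|auto].
Qed.

(** * The finite-injury construction *)

Definition persistent (On : nat -> nat -> bool) (s t : nat) : Prop :=
  forall s', s <= s' -> On s' t = On s t.

Definition differ (bit On : nat -> nat -> bool) (x y t : nat) : Prop :=
  (exists s, persistent On s t /\ On s t = true) /\ bit t x <> bit t y.

Section Construction.
(* All natural numbers are read as group elements here. *)
Context (act mul : nat -> nat -> nat) (inv : nat -> nat) (one : nat).
Context (act_one : forall x, act one x = x).
Context (act_mul : forall g h x, act (mul g h) x = act g (act h x)).
Context (act_inv_l : forall g x, act (inv g) (act g x) = x).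
Context (act_inv_r : forall g x, act g (act (inv g) x) = x).
Context (find : nat * (nat * list nat) -> nat * nat).
Context (find_fix : forall k d F x, In x F -> act (fst (find (k, (d, F)))) x = x).
Context (find_new : forall k d F, ~ In (snd (find (k, (d, F)))) F).
Context (find_neq : forall k d F,
  act k (act (fst (find (k, (d, F)))) (snd (find (k, (d, F))))) <> act d (snd (find (k, (d, F))))).
Context (bit : nat -> nat -> bool) (On : nat -> nat -> bool).
Context (On_cv : forall t, exists s, persistent On s t).

Lemma act_inj g x y : act g x = act g y -> x = y.
Proof. intros E; rewrite <- (act_inv_l g x), E; apply act_inv_l. Qed.

(* Position [t], the guess whether [t] is live, and the group element [h_t]. *)
Notation entry := (nat * (bool * nat))%type.

Definition elt (e : entry) : nat := snd (snd e).

(** Earlier factors stand to the left and act last, so changing an initial segment of the product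
    amounts to a multiplication on the left. *)
Definition prod_of (x : nat) (L : list entry) : nat :=
  fold_right (fun e a => if fst (snd e) && bit (fst e) x then mul (elt e) a else a) one L.

Definition all_prods (L : list entry) : list nat :=
  fold_right (fun e P => P ++ map (mul (elt e)) P) [one] L.

Definition saturate (C : list nat) (L : list entry) : list nat :=
  fold_right (fun e c => c ++ map (act (elt e)) c) C L.

(** The elements [u^-1 g v] that the next factor has to avoid. The bound on [g] grows with the list,
    so every [g] is eventually treated. *)
Definition targets (L : list entry) : list nat :=
  flat_map (fun u => flat_map (fun v => map (fun g => mul (inv u) (mul g v))
    (seq 0 (S (length L)))) (all_prods L)) (all_prods L).

(* Replaces [k] by [k g], with [g] fixing the points [F] decided so far, and decides a new
   point [q] of [C] so that [q] and [d^-1 k g q] are not both in or both out of [C]. *)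
Definition separate (d : nat) (p : nat * (list nat * list nat)) : nat * (list nat * list nat) :=
  let w := find (fst p, (d, fst (snd p))) in
  let k := mul (fst p) (fst w) in
  let q' := act (inv d) (act k (snd w)) in
  (k, (snd w :: q' :: fst (snd p), if mem q' (snd (snd p)) then snd (snd p) else snd w :: snd (snd p))).

Definition separate_all (D F C : list nat) : nat * (list nat * list nat) :=
  fold_right separate (one, (F, C)) D.

Definition up_to_date (s : nat) (e : entry) : bool := Bool.eqb (On s (fst e)) (fst (snd e)).

Definition cut (s : nat) (L : list entry) : list entry * list entry :=
  fold_right (fun e p => if up_to_date s e then (e :: fst p, snd p) else ([], e :: fst p ++ snd p))
    ([], []) L.

(* The current factors, the points decided so far, and those among them in [C]. *)
Definition state : Type := list entry * (list nat * list nat).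

(** Saturation may have put undecided points into [C]; they are added to [F] so that the new factor
    fixes them too. *)
Definition rebuild (s : nat) (K : list entry) (C F : list nat) : state :=
  let E := separate_all (targets K) (F ++ C) C in
  (K ++ [(length K, (On s (length K), fst E))], snd E).

Definition step (s : nat) (st : state) : state :=
  let p := cut s (fst st) in
  rebuild s (fst p) (saturate (snd (snd st)) (snd p)) (fst (snd st)).

Definition run (s : nat) : state :=
  nat_rect (fun _ => state) ([], ([], [])) (fun n st => step (S n) st) s.

Definition Ls s := fst (run s).
Definition Fs s := fst (snd (run s)).
Definition Cs s := snd (snd (run s)).

Definition V (x s : nat) : list nat := map (act (prod_of x (Ls s))) (Cs s).

(** * Partial products, saturation and separation *)

Lemma prod_of_app x K L z : act (prod_of x (K ++ L)) z = act (prod_of x K) (act (prod_of x L) z).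
Proof.
  induction K as [|e K IH]; simpl; [now rewrite act_one|].
  destruct (_ && _); rewrite ?act_mul, IH; auto.
Qed.

Lemma prod_of_In x L : In (prod_of x L) (all_prods L).
Proof.
  induction L as [|e L IH]; simpl; auto.
  apply in_or_app; destruct (_ && _); auto using in_map.
Qed.

Lemma saturate_In x C L c : In c C -> In (act (prod_of x L) c) (saturate C L).
Proof.
  intros Hc; induction L as [|e L IH]; simpl; [now rewrite act_one|].
  apply in_or_app; destruct (_ && _); rewrite ?act_mul; auto using in_map.
Qed.

Lemma targets_In L u v g :
  In u (all_prods L) -> In v (all_prods L) -> g <= length L ->
  In (mul (inv u) (mul g v)) (targets L).
Proof.
  intros Hu Hv Hg; apply in_flat_map; exists u; split; auto.
  apply in_flat_map; exists v; split; auto.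
  apply (in_map (fun g => mul (inv u) (mul g v))), in_seq; lia.
Qed.

Definition fixes (F : list nat) (g : nat) : Prop := forall x, In x F -> act g x = x.

Lemma fixes_back F g x : fixes F g -> In (act g x) F -> act g x = x.
Proof. intros Hg Hx; apply (act_inj g); auto. Qed.

(** By injectivity, an element fixing [F] pointwise sends no outside point into [F], so taking
    images adds no point of [F]. *)
Lemma saturate_fix F C L c :
  (forall e, In e L -> fixes F (elt e)) -> In c F -> (In c (saturate C L) <-> In c C).
Proof.
  intros HL Hc; induction L as [|e L IH]; simpl; [reflexivity|].
  simpl in HL; rewrite in_app_iff, IH by auto; split; [|auto].
  intros [H|H]; auto; apply in_map_iff in H as (y & <- & Hy).
  apply IH; [auto|].
  rewrite (fixes_back F); auto.
Qed.

Lemma prod_of_fix F x L : (forall e, In e L -> fixes F (elt e)) -> fixes F (prod_of x L).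
Proof.
  intros HL z Hz; induction L as [|e L IH]; simpl; [apply act_one|].
  simpl in HL; destruct (_ && _); rewrite ?act_mul, IH by auto; auto; now apply HL; auto.
Qed.

(** The point [act k q] then lies in exactly one of the images of [C] under [k] and [d]. *)
Definition separated (d k : nat) (F C : list nat) : Prop :=
  exists q q', In q F /\ In q' F /\ act d q' = act k q /\ (In q C <-> ~ In q' C).

(** Each correction fixes the points decided before and adds at most one fresh point to [C], so
    separations reached earlier survive. *)
Lemma separate_all_spec D F C (E := separate_all D F C) :
  incl C F ->
  fixes F (fst E) /\ incl F (fst (snd E)) /\ incl C (snd (snd E)) /\
  incl (snd (snd E)) (fst (snd E)) /\
  (forall x, In x F -> In x (snd (snd E)) -> In x C) /\
  (forall d, In d D -> separated d (fst E) (fst (snd E)) (snd (snd E))).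
Proof.
  intros HC; subst E; induction D as [|d D IH]; simpl.
  { repeat split; auto using incl_refl; [intros x _; apply act_one|contradiction]. }
  fold (separate_all D F C).
  destruct (separate_all D F C) as [k [F' C']]; unfold separate; simpl in *.
  pose proof (find_fix k d F') as Hfix.
  pose proof (find_new k d F') as Hnew.
  pose proof (find_neq k d F') as Hneq.
  destruct (find (k, (d, F'))) as [g q]; simpl in *.
  destruct IH as (H1 & H2 & H3 & H4 & H5 & H6).
  set (q' := act (inv d) (act (mul k g) q)).
  assert (Eq' : act d q' = act (mul k g) q) by apply act_inv_r.
  (* Distinctness comes from [find_neq]; it ensures that putting [q] into [C] does not put [q']
     there as well. *)
  assert (Hqq : q <> q') by (intros <-; rewrite act_mul in Eq'; congruence).
  set (C2 := if mem q' C' then C' else q :: C').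
  assert (HC2 : forall x, In x C2 <-> In x C' \/ (x = q /\ ~ In q' C')).
  { intros x; unfold C2; generalize (mem_In q' C'); destruct (mem q' C'); simpl; intros [Ha Hb].
    - specialize (Ha eq_refl); tauto.
    - assert (~ In q' C') by (intros Hi; apply Hb in Hi; discriminate).
      split; [intros [->|]; tauto|intros [|[-> ]]; tauto]. }
  clearbody C2 q'.
  repeat split.
  - intros x Hx; rewrite act_mul, Hfix; auto.
  - intros x Hx; simpl; auto.
  - intros x Hx; apply HC2; auto.
  - intros x Hx; apply HC2 in Hx as [Hx|[-> _]]; simpl; auto.
  - intros x Hx Hx2; apply HC2 in Hx2 as [|[-> _]]; [auto|].
    elim Hnew; auto.
  - intros d' [<-|Hd].
    + exists q, q'; simpl; repeat split; auto.
      * rewrite !HC2; intros [Hq|[_ Hq]]; [elim Hnew; auto|].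
        intros [|[? _]]; auto.
      * rewrite !HC2; intros Hq; right; tauto.
    + destruct (H6 d' Hd) as (r & r' & Hr & Hr' & Er & Hrr).
      assert (Hsame : forall x, In x F' -> (In x C2 <-> In x C')).
      { intros x Hx; rewrite HC2; split; [intros [|[-> _]]; [auto|contradiction]|auto]. }
      exists r, r'; simpl; repeat split; auto.
      * now rewrite act_mul, Hfix.
      * rewrite !Hsame; auto; tauto.
      * rewrite !Hsame; auto; tauto.
Qed.

(** * The effect of a single stage *)

Lemma cut_spec s L : let p := cut s L in
  L = fst p ++ snd p /\ forall e, In e (fst p) -> up_to_date s e = true.
Proof.
  induction L as [|e L [IH1 IH2]]; simpl; [split; [reflexivity|contradiction]|].
  fold (cut s L); destruct (up_to_date s e) eqn:E; simpl.
  - split; [now f_equal|intros e' [<-|]; auto].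
  - split; [now f_equal|contradiction].
Qed.

Lemma cut_app s K L :
  (forall e, In e K -> up_to_date s e = true) ->
  cut s (K ++ L) = (K ++ fst (cut s L), snd (cut s L)).
Proof.
  intros HK; induction K as [|e K IH]; simpl; [apply surjective_pairing|].
  simpl in HK; fold (cut s (K ++ L)); rewrite HK by auto.
  rewrite IH by auto; reflexivity.
Qed.

Lemma run_spec s (K := fst (cut (S s) (Ls s))) (R := snd (cut (S s) (Ls s)))
    (C := saturate (Cs s) R) :
  exists h, Ls (S s) = K ++ [(length K, (On (S s) (length K), h))] /\
    fixes (Fs s ++ C) h /\ incl (Fs s ++ C) (Fs (S s)) /\
    incl C (Cs (S s)) /\ incl (Cs (S s)) (Fs (S s)) /\
    (forall x, In x (Fs s ++ C) -> In x (Cs (S s)) -> In x C) /\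
    (forall d, In d (targets K) -> separated d h (Fs (S s)) (Cs (S s))).
Proof.
  exists (fst (separate_all (targets K) (Fs s ++ C) C)); split; [reflexivity|].
  apply (separate_all_spec (targets K)); apply incl_appr, incl_refl.
Qed.

Lemma Fs_mono s : incl (Fs s) (Fs (S s)).
Proof.
  destruct (run_spec s) as (h & _ & _ & Hi & _).
  eapply incl_tran; [apply incl_appl, incl_refl|exact Hi].
Qed.

Lemma Fs_mono_le s s' : s <= s' -> incl (Fs s) (Fs s').
Proof. induction 1; [apply incl_refl|eapply incl_tran; eauto using Fs_mono]. Qed.

(** The old product applies the discarded factors [R] first. Saturation puts the resulting point
    into the new [C], and the new factor fixes it. *)
Lemma V_mono x s : incl (V x s) (V x (S s)).
Proof.
  intros z Hz; apply in_map_iff in Hz as (c & <- & Hc).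
  destruct (run_spec s) as (h & HL & Hf & _ & Hi & _); unfold V; rewrite HL; clear HL.
  destruct (cut_spec (S s) (Ls s)) as [E _]; rewrite E at 1.
  set (K := fst _) in *; set (R := snd (cut _ _)) in *; set (C := saturate _ _) in *.
  assert (Hin : In (act (prod_of x R) c) C) by now apply saturate_In.
  apply in_map_iff; exists (act (prod_of x R) c); split; [|auto].
  rewrite !prod_of_app; f_equal.
  apply (prod_of_fix (Fs s ++ C)); [intros e [<-|[]]; exact Hf|].
  apply in_or_app; auto.
Qed.

Lemma V_mono_le x s s' : s <= s' -> incl (V x s) (V x s').
Proof. induction 1; [apply incl_refl|eapply incl_tran; eauto using V_mono]. Qed.

Lemma Ls_index s i e : nth_error (Ls s) i = Some e -> fst e = i.
Proof.
  revert i e; induction s as [|s IH]; intros i e; [destruct i; discriminate|].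
  destruct (run_spec s) as (h & -> & _).
  destruct (cut_spec (S s) (Ls s)) as [E _].
  set (K := fst _) in *; intros He.
  destruct (lt_dec i (length K)) as [Hi|Hi].
  - rewrite nth_error_app1 in He by auto.
    apply IH; rewrite E, nth_error_app1; auto.
  - rewrite nth_error_app2 in He by lia.
    destruct (i - length K) as [|[|j]] eqn:Ei; try discriminate.
    injection He as <-; simpl; lia.
Qed.

(** * True stages, whose entries are never discarded later *)

Definition true_stage (s : nat) : Prop :=
  forall s' e, s <= s' -> In e (Ls s) -> up_to_date s' e = true.

(** Every later factor fixes the points decided by stage [s]. Hence saturation adds none of them to
    [C], and separation adds only points undecided before. *)
Lemma true_stage_tail s : true_stage s -> forall s', s <= s' ->
  exists R, Ls s' = Ls s ++ R /\ (forall e, In e R -> fixes (Fs s) (elt e)) /\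
    forall x, In x (Fs s) -> (In x (Cs s') <-> In x (Cs s)).
Proof.
  intros HT s' Hs; induction Hs as [|s' Hs (R & HR & Hfix & HC)].
  { exists []; rewrite app_nil_r; repeat split; auto; contradiction. }
  destruct (run_spec s') as (h & -> & H1 & _ & H3 & _ & H5 & _).
  rewrite HR, cut_app in *; simpl in *; try (intros; apply HT; auto with arith).
  destruct (cut_spec (S s') R) as [E _].
  set (P := fst _) in *; set (Q := snd (cut _ _)) in *.
  set (C := saturate _ _) in *.
  assert (HsatQ : forall e, In e Q -> fixes (Fs s) (elt e))
    by (intros e He; apply Hfix; rewrite E; apply in_or_app; auto).
  assert (Hle : incl (Fs s) (Fs s' ++ C)) by (apply incl_appl, Fs_mono_le; auto).
  eexists; split; [symmetry; apply app_assoc|]; split.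
  - intros e He; apply in_app_or in He as [He|[<-|[]]].
    + apply Hfix; rewrite E; apply in_or_app; auto.
    + intros x Hx; apply H1; auto.
  - intros x Hx; rewrite <- HC by auto.
    rewrite <- (saturate_fix (Fs s) (Cs s') Q x HsatQ Hx); fold C.
    split; auto.
Qed.

(** The later factors fix [p], so the product at stage [s] already gives its final image, and
    whether [p] is in [C] no longer changes. *)
Lemma true_stage_V x s p : true_stage s -> In p (Fs s) ->
  (exists s', In (act (prod_of x (Ls s)) p) (V x s')) <-> In p (Cs s).
Proof.
  intros HT Hp; split.
  - intros (s' & Hin).
    apply (V_mono_le x s' (max s s')) in Hin; [|lia].
    destruct (true_stage_tail s HT (max s s')) as (R & HR & Hfix & HC); [lia|].
    unfold V in Hin; rewrite HR in Hin.
    apply in_map_iff in Hin as (c & Ec & Hc).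
    rewrite prod_of_app in Ec; apply act_inj in Ec.
    assert (HfR := prod_of_fix _ x R Hfix).
    assert (c = p) as -> by (apply (act_inj (prod_of x R)); rewrite (HfR p); auto).
    now apply HC.
  - intros Hc; exists s; now apply in_map.
Qed.

(** Once the first [m] entries are permanent, position [m] is refilled only when its guess changes,
    hence finitely often. The stage appending its final version has that entry last, which gives the
    exact length. *)
Lemma true_stage_length m : exists s, m <= s /\ true_stage s /\ length (Ls s) = m.
Proof.
  induction m as [|m (s & Hs & HT & Hl)].
  { exists 0; repeat split; auto; intros s' e _ []. }
  (* [u] is the stage at which the entry now at position [m] was appended. *)
  assert (Hind : forall s', S s <= s' -> exists u e R, S s <= u <= s' /\
            Ls u = Ls s ++ [e] /\ fst e = m /\
            Ls s' = Ls s ++ e :: R /\ forall v, u <= v <= s' -> up_to_date v e = true).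
  { intros s' Hs'; induction Hs' as [|s' Hs' (u & e & R & Hu & EL & Ee & ER & Hup)].
    - destruct (run_spec s) as (h & EL & _).
      rewrite <- (app_nil_r (Ls s)), cut_app in EL by (intros; apply HT; auto).
      simpl in EL; rewrite app_nil_r in EL.
      eexists (S s), _, []; repeat split; eauto.
      intros v Hv; replace v with (S s) by lia.
      apply Bool.eqb_true_iff; reflexivity.
    - destruct (run_spec s') as (h & EL' & _).
      rewrite ER, cut_app in EL' by (intros; apply HT; auto with arith).
      simpl in EL'; fold (cut (S s') R) in EL'.
      destruct (up_to_date (S s') e) eqn:Eup; simpl in EL'.
      + rewrite <- app_assoc in EL'.
        eexists u, e, _; repeat split; eauto; try lia.
        intros v Hv; destruct (Nat.eq_dec v (S s')) as [->|]; auto.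
        apply Hup; lia.
      + rewrite app_nil_r in EL'.
        eexists (S s'), _, []; repeat split; eauto; try lia.
        intros v Hv; replace v with (S s') by lia.
        apply Bool.eqb_true_iff; reflexivity. }
  (* From stage [w] on the guess about [m] is constant, so the entry present then is permanent. *)
  destruct (On_cv m) as [w Hw].
  destruct (Hind (max (S s) w)) as (u & e & R & Hu & EL & Ee & ER & Hup); [lia|].
  exists u; repeat split; [lia| |rewrite EL, length_app; simpl; lia].
  intros v e' Hv He'; rewrite EL in He'.
  apply in_app_or in He' as [He'|[<-|[]]]; [apply HT; auto; lia|].
  destruct (le_dec v (max (S s) w)) as [Hle|Hle]; [apply Hup; lia|].
  rewrite <- (Hup (max (S s) w)) by lia.
  unfold up_to_date; rewrite Ee, (Hw v), (Hw (max (S s) w)) by lia; reflexivity.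
Qed.

Lemma last_separated s K e g x y :
  Ls s = K ++ [e] -> g <= length K ->
  separated (mul (inv (prod_of x K)) (mul g (prod_of y K))) (elt e) (Fs s) (Cs s).
Proof.
  destruct s as [|s]; [destruct K; discriminate|].
  destruct (run_spec s) as (h & -> & _ & _ & _ & _ & _ & Hsep); intros E Hg.
  apply app_inj_tail in E as [<- <-].
  apply Hsep, targets_In; auto using prod_of_In.
Qed.

(** * Equivalence of the enumerated sets and bounded differences *)

Definition inV (x z : nat) : Prop := exists s, In z (V x s).

Definition equivalent (x y : nat) : Prop :=
  exists g, forall z, inV x z <-> exists z', inV y z' /\ z = act g z'.

(** Let [u], [v] be the products of [x], [y] over [K], and [h] the last factor. Separation from
    [u^-1 g v] gives [u h q = g v q']. This point is in the set of [x] iff [q] is in [C], and in the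
    image under [g] of the set of [y] iff [q'] is in [C]. *)
Lemma last_diagonalizes s K e g x y :
  true_stage s -> Ls s = K ++ [e] -> g <= length K ->
  fst (snd e) = true -> bit (fst e) x = true -> bit (fst e) y = false ->
  ~ (forall z, inV x z <-> exists z', inV y z' /\ z = act g z').
Proof.
  intros HT EL Hg Hf Hx Hy Heq.
  destruct (last_separated s K e g x y EL Hg) as (q & q' & Hq & Hq' & Eq & Hiff).
  rewrite !act_mul in Eq.
  assert (Ex : act (prod_of x (Ls s)) q = act (prod_of x K) (act (elt e) q)).
  { rewrite EL, prod_of_app; simpl; rewrite Hf, Hx; simpl; now rewrite act_mul, act_one. }
  assert (Ey : act (prod_of y (Ls s)) q' = act (prod_of y K) q').
  { rewrite EL, prod_of_app; simpl; rewrite Hf, Hy; simpl; now rewrite act_one. }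
  assert (Ez : act (prod_of x (Ls s)) q = act g (act (prod_of y (Ls s)) q')).
  { rewrite Ex, Ey, <- Eq; apply act_inv_r. }
  pose proof (true_stage_V x s q HT Hq) as Vx; fold (inV x (act (prod_of x (Ls s)) q)) in Vx.
  pose proof (true_stage_V y s q' HT Hq') as Vy; fold (inV y (act (prod_of y (Ls s)) q')) in Vy.
  assert (inV x (act (prod_of x (Ls s)) q) <-> inV y (act (prod_of y (Ls s)) q')).
  { rewrite Heq; split.
    - intros (z' & Hz' & E); rewrite Ez in E; apply act_inj in E; congruence.
    - eauto. }
  tauto.
Qed.

Lemma equivalent_bounded x y : equivalent x y -> exists b, forall t, differ bit On x y t -> t < b.
Proof.
  (* The bound puts both [g] and [inv g] among the elements treated at position [t]; the inverse
     serves when only [y] has the bit. *)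
  intros [g Hg]; exists (S (g + inv g)); intros t [(w & Hw & Ow) Hd].
  apply NNPP; intros Ht.
  destruct (true_stage_length (S t)) as (s & Hs & HT & Hl).
  destruct (exists_last (l := Ls s)) as (K & e & EL); [intros E; rewrite E in Hl; discriminate|].
  rewrite EL, length_app in Hl; simpl in Hl.
  assert (Ee : fst e = t).
  { apply (Ls_index s); rewrite EL, nth_error_app2 by lia.
    replace (t - length K) with 0 by lia; reflexivity. }
  assert (Hflag : fst (snd e) = true).
  { assert (Hup : up_to_date (max s w) e = true)
      by (apply HT; [lia|rewrite EL; apply in_or_app; simpl; auto]).
    apply Bool.eqb_prop in Hup; rewrite Ee, Hw in Hup by lia; congruence. }
  destruct (bit t x) eqn:Ex, (bit t y) eqn:Ey; try congruence.
  - apply (last_diagonalizes s K e g x y); auto; try lia; congruence.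
  - apply (last_diagonalizes s K e (inv g) y x); auto; try lia; try congruence.
    intros z; split.
    + intros Hz; exists (act g z); split; [apply Hg; eauto|now rewrite act_inv_l].
    + intros (z' & Hz' & ->); apply Hg in Hz' as (z & Hz & ->); now rewrite act_inv_l.
Qed.

(** Flags at a later true stage are final, so a flagged factor past stage [s] with different bits
    would contradict the bound. Both products therefore have the same tail [R]. *)
Lemma bounded_transfer s x y z :
  true_stage s -> (forall t, differ bit On x y t -> t < length (Ls s)) ->
  inV x z -> inV y (act (prod_of y (Ls s)) (act (inv (prod_of x (Ls s))) z)).
Proof.
  intros HT Hb (s1 & Hz).
  destruct (true_stage_length (max s s1)) as (s2 & Hs2 & HT2 & _).
  apply (V_mono_le x s1 s2) in Hz; [|lia].
  destruct (true_stage_tail s HT s2) as (R & HR & _); [lia|].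
  assert (ER : prod_of x R = prod_of y R).
  { assert (HRe : forall e, In e R -> fst (snd e) && bit (fst e) x = fst (snd e) && bit (fst e) y).
    { intros e He; destruct (fst (snd e)) eqn:Ef; [|reflexivity]; simpl.
      destruct (Bool.bool_dec (bit (fst e) x) (bit (fst e) y)) as [|Hne]; [assumption|exfalso].
      assert (Hup : forall v, s2 <= v -> On v (fst e) = true).
      { intros v Hv; rewrite <- Ef; apply Bool.eqb_prop.
        apply (HT2 v e Hv); rewrite HR; apply in_or_app; auto. }
      apply In_nth_error in He as [i Hi].
      assert (Ei : fst e = length (Ls s) + i).
      { apply (Ls_index s2); rewrite HR, nth_error_app2 by lia.
        replace (length (Ls s) + i - length (Ls s)) with i by lia; assumption. }
      enough (fst e < length (Ls s)) by lia.
      apply Hb; split; [|assumption].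
      exists s2; split; [intros v Hv|]; rewrite !Hup; auto. }
    clear - HRe; induction R as [|e R IH]; simpl in *; [reflexivity|].
    rewrite HRe, IH by auto; reflexivity. }
  exists s2; unfold V in *; rewrite HR in *.
  apply in_map_iff in Hz as (c & <- & Hc).
  apply in_map_iff; exists c; split; [|assumption].
  rewrite !prod_of_app, act_inv_l, ER; reflexivity.
Qed.

Lemma bounded_equivalent x y : (exists b, forall t, differ bit On x y t -> t < b) -> equivalent x y.
Proof.
  intros [b Hb].
  destruct (true_stage_length b) as (s & Hs & HT & Hl).
  exists (mul (prod_of x (Ls s)) (inv (prod_of y (Ls s)))); intros z; split.
  - intros Hz; eexists; split; [apply (bounded_transfer s x y z); auto; now rewrite Hl|].
    now rewrite act_mul, act_inv_l, act_inv_r.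
  - intros (z' & Hz' & ->); rewrite act_mul.
    apply bounded_transfer; auto; rewrite Hl.
    intros t [H1 H2]; apply Hb; split; auto.
Qed.

(** * Computability of the construction *)

Context (Comp_act : Comp (fun p => act (fst p) (snd p))).
Context (Comp_mul : Comp (fun p => mul (fst p) (snd p))).
Context (Comp_inv : Comp inv) (Comp_find : Comp find).
Context (Comp_bit : Comp (fun p => bit (fst p) (snd p))).
Context (Comp_On : Comp (fun p => On (fst p) (snd p))).

Lemma Comp_all_prods : Comp all_prods.
Proof. unfold all_prods, elt; comp. Qed.

Lemma Comp_targets : Comp targets.
Proof.
  pose proof Comp_all_prods; unfold targets; comp.
Qed.

Lemma Comp_separate : Comp (fun p => separate (fst p) (snd p)).
Proof. unfold separate; cbv zeta; comp. Qed.

Lemma Comp_step : Comp (fun p => step (fst p) (snd p)).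
Proof.
  assert (H1 : Comp (fun p => saturate (fst p) (snd p))) by (unfold saturate, elt; comp).
  assert (H2 : Comp (fun p => cut (fst p) (snd p))) by (unfold cut, up_to_date; comp).
  pose proof Comp_targets; pose proof Comp_separate.
  unfold step, rebuild, separate_all; cbv zeta; comp.
Qed.

Lemma Comp_run : Comp run.
Proof.
  pose proof Comp_step; unfold run; comp.
Qed.

Lemma Comp_V : Comp (fun p => V (fst p) (snd p)).
Proof.
  pose proof Comp_run.
  assert (Comp (fun p => prod_of (fst p) (snd p))) by (unfold prod_of, elt; comp).
  unfold V, Ls, Cs; comp.
Qed.

Lemma family_exists : exists f, computable f /\ forall x y,
  (exists g, forall z, W (f x) z <-> exists z', W (f y) z' /\ z = act g z') <->
  exists b, forall t, differ bit On x y t -> t < b.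
Proof.
  pose proof Comp_V.
  destruct (ce_index (fun x z s => mem z (V x s))) as (f & Hf & HW); [comp|].
  exists f; split; [assumption|]; intros x y.
  assert (E : forall x z, W (f x) z <-> inV x z).
  { intros a z; rewrite HW; unfold inV; split; intros [s Hs]; exists s; now apply mem_In. }
  transitivity (equivalent x y).
  - unfold equivalent; split; intros [g Hg]; exists g; intros z; specialize (Hg z).
    + rewrite <- E, Hg; split; intros (z' & H1 & H2); exists z'; [rewrite <- E|rewrite E]; auto.
    + rewrite E, Hg; split; intros (z' & H1 & H2); exists z'; [rewrite E|rewrite <- E]; auto.
  - split; [apply equivalent_bounded|apply bounded_equivalent].
Qed.
End Construction.

(** * Computable sets and binary functions in terms of [Comp] *)

Lemma computable_set_Comp A : computable_set A ->
  exists a : nat -> bool, Comp a /\ forall x, a x = true <-> A x.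
Proof.
  intros (f & Hf & HA); exists (fun x => f x =? 1); split.
  - assert (Comp f) by exact Hf; comp.
  - intros x; rewrite Nat.eqb_eq; split; [|apply HA].
    intros E; apply NNPP; intros HN; apply HA in HN; lia.
Qed.

Lemma computable2_Comp f : computable2 f -> Comp (fun p => f (fst p) (snd p)).
Proof.
  intros [c Hc]; exists c; intros [x y].
  generalize (Hc (cpair x y)); rewrite of_nat_cpair; auto.
Qed.

(** * A normal form for [Sigma03] equivalence relations *)

Lemma bounded_uniform (P : nat -> nat -> Prop) n :
  (forall i, i < n -> exists b, forall t, P i t -> t < b) ->
  exists b, forall i t, i < n -> P i t -> t < b.
Proof.
  induction n as [|n IH]; intros H; [exists 0; lia|].
  destruct IH as [b Hb]; [auto|]; destruct (H n) as [b' Hb']; [auto|].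
  exists (max b b'); intros i t Hi Ht.
  destruct (Nat.eq_dec i n) as [->|]; [apply Hb' in Ht|apply Hb in Ht]; lia.
Qed.

Lemma monotone_bool_cv (f : nat -> bool) :
  (forall s s', s <= s' -> f s = true -> f s' = true) ->
  exists s, forall s', s <= s' -> f s' = f s.
Proof.
  intros Hf; destruct (classic (exists s, f s = true)) as [[s Hs]|HN].
  - exists s; intros s' Hle; rewrite Hs; eauto.
  - exists 0; intros s' _.
    assert (E : forall s, f s = false).
    { intros s; destruct (f s) eqn:E; [elim HN; eauto|reflexivity]. }
    now rewrite !E.
Qed.

Definition subsets (n : nat) : list (list nat) :=
  nat_rect (fun _ => list (list nat)) [[]] (fun m P => P ++ map (cons m) P) n.

(** [P] need not be decidable, so excluded middle selects the sublist; the case of interest is an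
    [E]-class. *)
Lemma subsets_spec (P : nat -> Prop) n :
  exists l, In l (subsets n) /\ forall x, In x l <-> x < n /\ P x.
Proof.
  induction n as [|n (l & Hl & Hx)].
  { exists []; split; [simpl; auto|]; intros x; simpl; lia. }
  change (subsets (S n)) with (subsets n ++ map (cons n) (subsets n)).
  destruct (classic (P n)) as [Hn|Hn].
  - exists (n :: l); split; [apply in_or_app; auto using in_map|].
    intros x; simpl; rewrite Hx; split.
    + intros [<-|[? ?]]; auto.
    + intros [? ?]; destruct (Nat.eq_dec x n); auto; right; split; auto; lia.
  - exists l; split; [apply in_or_app; auto|].
    intros x; rewrite Hx; split; intros [? ?]; split; auto.
    destruct (Nat.eq_dec x n) as [->|]; [contradiction|lia].
Qed.

(** * Crossings of finite sets *)

Section NormalForm.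
Context (E : nat -> nat -> Prop) (HE : Equivalence E) (a : nat -> bool) (Comp_a : Comp a).
Context (E_iff : forall x y, E x y <->
  exists i, forall b, exists c, a (cpair (cpair x y) (cpair i (cpair b c))) = true).

(** The stage [s] bounds only the witness [c], so the test is increasing in [s] and decreasing in
    the depth [k]. *)
Definition crosses (s n : nat) (l : list nat) (k : nat) : bool :=
  existsb (fun x => existsb (fun y => existsb (fun i =>
    xorb (mem x l) (mem y l) && forallb (fun b => existsb (fun c =>
      a (cpair (cpair x y) (cpair i (cpair b c)))) (seq 0 s)) (seq 0 k))
    (seq 0 n)) (seq 0 n)) (seq 0 n).

Lemma existsb_seq f n : existsb f (seq 0 n) = true <-> exists x, x < n /\ f x = true.
Proof.
  rewrite existsb_exists; split; intros (x & Hx & Hf); exists x; split; auto;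
    [apply in_seq in Hx; lia|apply in_seq; lia].
Qed.

Lemma forallb_seq f n : forallb f (seq 0 n) = true <-> forall x, x < n -> f x = true.
Proof.
  rewrite forallb_forall; split; intros H x Hx; apply H; [apply in_seq|apply in_seq in Hx]; lia.
Qed.

Lemma crosses_iff s n l k : crosses s n l k = true <->
  exists x y i, x < n /\ y < n /\ i < n /\ mem x l <> mem y l /\
    forall b, b < k -> exists c, c < s /\ a (cpair (cpair x y) (cpair i (cpair b c))) = true.
Proof.
  unfold crosses; rewrite existsb_seq; split.
  - intros (x & Hx & H); apply existsb_seq in H as (y & Hy & H).
    apply existsb_seq in H as (i & Hi & H); apply andb_true_iff in H as [H1 H2].
    exists x, y, i; repeat split; auto.
    + intros Exy; rewrite Exy, xorb_nilpotent in H1; discriminate.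
    + intros b Hb; eapply forallb_seq in H2; [|exact Hb].
      now apply existsb_seq in H2.
  - intros (x & y & i & Hx & Hy & Hi & Hne & H).
    exists x; split; auto; apply existsb_seq; exists y; split; auto.
    apply existsb_seq; exists i; split; auto; apply andb_true_iff; split.
    + destruct (mem x l), (mem y l); simpl; congruence.
    + apply forallb_seq; intros b Hb; apply existsb_seq; auto.
Qed.

Lemma crosses_mono s s' n l k k' :
  s <= s' -> k' <= k -> crosses s n l k = true -> crosses s' n l k' = true.
Proof.
  rewrite !crosses_iff; intros Hs Hk (x & y & i & Hx & Hy & Hi & Hne & H).
  exists x, y, i; repeat split; auto; intros b Hb.
  destruct (H b) as (c & Hc & Ha); [lia|]; exists c; split; auto; lia.
Qed.

(* [t] codes [((n, j), k)], where [j] numbers the subsets of [{0, ..., n-1}]; numbers that are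
   too large denote the empty set. *)
Definition width (t : nat) : nat := fst (Cantor.of_nat (fst (Cantor.of_nat t))).
Definition number (t : nat) : nat := snd (Cantor.of_nat (fst (Cantor.of_nat t))).
Definition attempt (t : nat) : nat := snd (Cantor.of_nat t).
Definition cutset (t : nat) : list nat := nth (number t) (subsets (width t)) [].

Definition cut_bit (t x : nat) : bool := mem x (cutset t).

(** Depth 0 is granted outright, since [crosses] at depth 0 still asks for two separated numbers. *)
Definition live (s t : nat) : bool :=
  ((attempt t =? 0) || crosses s (width t) (cutset t) (attempt t)) &&
  negb (crosses s (width t) (cutset t) (S (attempt t))).

(** As [s] grows, the first conjunct of [live] can only become true and the second only false. *)
Lemma live_cv t : exists s, persistent live s t.
Proof.
  destruct (monotone_bool_cv (fun s => crosses s (width t) (cutset t) (attempt t))) as [s1 H1].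
  { intros; eapply crosses_mono; eauto. }
  destruct (monotone_bool_cv (fun s => crosses s (width t) (cutset t) (S (attempt t)))) as [s2 H2].
  { intros; eapply crosses_mono; eauto. }
  exists (max s1 s2); intros s' Hs; unfold live.
  now rewrite (H1 s'), (H2 s'), (H1 (max s1 s2)), (H2 (max s1 s2)) by lia.
Qed.

Lemma Comp_cutset : Comp cutset.
Proof.
  assert (Comp subsets) by (unfold subsets; comp).
  unfold cutset, width, number; comp.
Qed.

Lemma Comp_cut_bit : Comp (fun p => cut_bit (fst p) (snd p)).
Proof. pose proof Comp_cutset; unfold cut_bit; comp. Qed.

Lemma Comp_live : Comp (fun p => live (fst p) (snd p)).
Proof.
  pose proof Comp_cutset.
  assert (Hc : Comp (fun q => (fun (p : nat * nat) (r : list nat * nat) =>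
      crosses (fst p) (snd p) (fst r) (snd r)) (fst q) (snd q))).
  { unfold crosses; comp. }
  assert (Hc' : forall k : nat * nat -> nat, Comp k ->
            Comp (fun p : nat * nat => crosses (fst p) (width (snd p)) (cutset (snd p)) (k p))).
  { intros k Hk.
    apply (Comp_app2 (fun (p : nat * nat) (r : list nat * nat) =>
             crosses (fst p) (snd p) (fst r) (snd r))
             (fun p => (fst p, width (snd p))) (fun p => (cutset (snd p), k p)) Hc);
      unfold width; comp. }
  unfold live; comp.
  - unfold attempt; comp.
  - apply Hc'; unfold attempt; comp.
  - apply Hc'; unfold attempt; comp.
Qed.

(** Once [n] exceeds [x], [y] and the witness [i], the pair itself crosses every set separating it;
    the finitely many [b < k] need only finitely many [c]. *)
Lemma related_crosses x y : E x y -> exists n0, forall n l k, n0 <= n ->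
  mem x l <> mem y l -> exists s, crosses s n l k = true.
Proof.
  intros Exy; apply E_iff in Exy as [i Hi].
  exists (S (x + y + i)); intros n l k Hn Hne.
  assert (Hs : exists s, forall b, b < k ->
            exists c, c < s /\ a (cpair (cpair x y) (cpair i (cpair b c))) = true).
  { induction k as [|k [s IH]]; [exists 0; lia|].
    destruct (Hi k) as [c Hc]; exists (max s (S c)); intros b Hb.
    destruct (Nat.eq_dec b k) as [->|].
    - exists c; split; auto; lia.
    - destruct (IH b) as (c' & ? & ?); [lia|]; exists c'; split; auto; lia. }
  destruct Hs as [s Hs]; exists s; apply crosses_iff.
  exists x, y, i; repeat split; auto; lia.
Qed.

(* Pigeonhole: one of the finitely many triples below [n] witnesses crossings of
   unbounded, hence of every, depth. *)
Lemma invariant_not_crossed n l :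
  (forall x y, x < n -> y < n -> E x y -> mem x l = mem y l) ->
  exists k, forall s, crosses s n l k = false.
Proof.
  intros Hinv.
  assert (H1 : forall x, x < n -> forall y, y < n -> forall i, i < n -> exists b,
    forall k, mem x l <> mem y l /\ (forall b, b < k -> exists c,
      a (cpair (cpair x y) (cpair i (cpair b c))) = true) -> k < b).
  { intros x Hx y Hy i Hi; apply NNPP; intros HN.
    assert (Hne : mem x l <> mem y l).
    { intros Exy; apply HN; exists 0; tauto. }
    apply Hne, Hinv; auto; apply E_iff; exists i; intros b.
    apply NNPP; intros Hc; apply HN; exists (S b); intros k [_ Hk].
    apply NNPP; intros Hlt; apply Hc, Hk; lia. }
  assert (H2 : exists K, forall x, x < n -> forall y, y < n -> forall i, i < n ->
    forall k, mem x l <> mem y l /\ (forall b, b < k -> exists c,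
      a (cpair (cpair x y) (cpair i (cpair b c))) = true) -> k < K).
  { edestruct (bounded_uniform (fun x k => exists y i, y < n /\ i < n /\
      mem x l <> mem y l /\ (forall b, b < k -> exists c,
      a (cpair (cpair x y) (cpair i (cpair b c))) = true)) n) as [K HK].
    { intros x Hx.
      edestruct (bounded_uniform (fun y k => exists i, i < n /\
        mem x l <> mem y l /\ (forall b, b < k -> exists c,
        a (cpair (cpair x y) (cpair i (cpair b c))) = true)) n) as [K HK].
      { intros y Hy; destruct (bounded_uniform _ n (H1 x Hx y Hy)) as [K HK].
        exists K; intros k (i & Hi & H); eapply HK; eauto. }
      exists K; intros k (y & i & Hy & H); eapply HK; eauto. }
    exists K; intros x Hx y Hy i Hi k [? ?]; apply (HK x k Hx); eauto 8. }
  destruct H2 as [K HK]; exists K; intros s.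
  destruct (crosses s n l K) eqn:Ec; [|reflexivity]; exfalso.
  apply crosses_iff in Ec as (x & y & i & Hx & Hy & Hi & Hne & H).
  apply (Nat.lt_irrefl K), (HK x Hx y Hy i Hi); split; auto.
  intros b Hb; destruct (H b Hb) as (c & _ & Hc); eauto.
Qed.

(** * Live triples and the relation *)

Lemma live_true t : (exists s, persistent live s t /\ live s t = true) <->
  (attempt t = 0 \/ exists s, crosses s (width t) (cutset t) (attempt t) = true) /\
  forall s, crosses s (width t) (cutset t) (S (attempt t)) = false.
Proof.
  split.
  - intros (s & Hp & Hl); split.
    + apply andb_true_iff in Hl as [Hl _]; apply orb_true_iff in Hl as [Hl|Hl]; eauto.
      left; now apply Nat.eqb_eq.
    + intros s'; destruct (crosses s' _ _ _) eqn:Ec; [exfalso|reflexivity].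
      apply (crosses_mono s' (max s s') _ _ _ (S (attempt t))) in Ec; [|lia|lia].
      rewrite <- (Hp (max s s')) in Hl by lia; unfold live in Hl.
      rewrite Ec, andb_false_r in Hl; discriminate.
  - intros [H1 H2].
    assert (Hs : exists s0, forall s, s0 <= s -> live s t = true).
    { unfold live; destruct H1 as [H1|[s0 H1]].
      - exists 0; intros s _; now rewrite H2, H1.
      - exists s0; intros s Hs; rewrite H2, (crosses_mono s0 s _ _ (attempt t)); auto.
        now rewrite orb_true_r. }
    destruct Hs as [s0 Hs]; exists s0; split; [intros s Hle|]; rewrite !Hs; auto.
Qed.

(** Sets of width at least [n0] that separate the pair are crossed to every depth and never live.
    Below [n0] there are finitely many sets, each with at most one exact depth. *)
Lemma related_bounded x y : E x y -> exists b, forall t, differ cut_bit live x y t -> t < b.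
Proof.
  intros Exy; destruct (related_crosses x y Exy) as [n0 Hn0].
  assert (Hw : forall t, differ cut_bit live x y t -> width t < n0 /\
            number t < length (subsets (width t))).
  { intros t [Hl Hne]; apply live_true in Hl as [_ Hl]; split; apply NNPP; intros Hge.
    - destruct (Hn0 (width t) (cutset t) (S (attempt t))) as [s Hs]; [lia|exact Hne|].
      rewrite Hl in Hs; discriminate.
    - apply Hne; unfold cut_bit, cutset; rewrite nth_overflow by lia; reflexivity. }
  destruct (bounded_uniform (fun n t => width t = n /\ differ cut_bit live x y t) n0) as [b Hb].
  { intros n _.
    destruct (bounded_uniform (fun j t => number t = j /\ width t = n /\
      differ cut_bit live x y t) (length (subsets n))) as [b Hb].
    { intros j _; apply NNPP; intros HN.
      assert (Hex : forall b, exists t, number t = j /\ width t = n /\ differ cut_bit live x y t /\ b <= t).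
      { intros b; apply NNPP; intros HN'; apply HN; exists b; intros t (H1 & H2 & H3).
        apply NNPP; intros Hlt; apply HN'; exists t; repeat split; auto; try apply H3; lia. }
      destruct (Hex 0) as (t & H1 & H2 & H3 & _).
      (* A second difference for the same set, taken above the code of the first, would have the
         same depth and hence the same code. *)
      destruct (Hex (S (cpair (cpair n j) (attempt t)))) as (t' & H1' & H2' & H3' & Hle).
      assert (Hgen : forall u, u = cpair (cpair (width u) (number u)) (attempt u)).
      { intros u; unfold width, number, attempt, cpair.
        rewrite <- surjective_pairing, Cantor.cancel_to_of.
        now rewrite <- surjective_pairing, Cantor.cancel_to_of. }
      assert (Hsame : forall u v, number u = j -> width u = n -> number v = j -> width v = n ->
                differ cut_bit live x y u -> differ cut_bit live x y v -> attempt u <= attempt v).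
      { intros u v Hu1 Hu2 Hv1 Hv2 [Hu _] [Hv _]; apply NNPP; intros Hlt.
        apply live_true in Hu as [[Hu|[s Hu]] _]; [lia|].
        apply live_true in Hv as [_ Hv]; specialize (Hv s).
        unfold cutset in Hu, Hv; rewrite Hv1, Hv2 in Hv; rewrite Hu1, Hu2 in Hu.
        rewrite (crosses_mono s s _ _ (attempt u)) in Hv; auto; [discriminate|lia]. }
      assert (Ek : attempt t = attempt t') by (apply Nat.le_antisymm; apply Hsame; auto).
      rewrite (Hgen t'), H1', H2', <- Ek in Hle; lia. }
    exists b; intros t [Ht Hd]; apply (Hb (number t) t); auto.
    rewrite <- Ht; now apply Hw. }
  exists b; intros t Ht; apply (Hb (width t) t); auto; now apply Hw.
Qed.

Lemma unrelated_unbounded x y b : ~ E x y -> exists t, differ cut_bit live x y t /\ b <= t.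
Proof.
  intros HN.
  (* [n] exceeds [x] and [y], so the class below [n] separates them, and exceeds [b], so every code
     of width [n] does. *)
  pose (n := S (x + y + b)).
  destruct (subsets_spec (E x) n) as (l & Hl & Hx).
  destruct (In_nth _ _ [] Hl) as (j & Hj & Ej).
  destruct (invariant_not_crossed n l) as [k0 Hk0].
  { intros u v Hu Hv Huv; apply eq_true_iff_eq; rewrite !mem_In, !Hx.
    split; intros [_ H]; split; auto; [transitivity u|transitivity v]; auto; now symmetry. }
  (* The least [k] without a crossing of depth [S k] is the exact depth. *)
  destruct (dec_inh_nat_subset_has_unique_least_element
    (fun k => forall s, crosses s n l (S k) = false)) as (k & [Hk Hmin] & _).
  { intros k; apply classic. }
  { exists k0; intros s; destruct (crosses s n l (S k0)) eqn:Ec; [|reflexivity].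
    rewrite <- (Hk0 s); symmetry; apply (crosses_mono s s n l (S k0)); auto. }
  exists (cpair (cpair n j) k).
  assert (Et : width (cpair (cpair n j) k) = n /\ cutset (cpair (cpair n j) k) = l /\
               attempt (cpair (cpair n j) k) = k).
  { unfold cutset, width, number, attempt; rewrite !of_nat_cpair; cbn [fst snd].
    rewrite of_nat_cpair; auto. }
  destruct Et as (E1 & E2 & E3).
  repeat split.
  - apply live_true; rewrite E1, E2, E3; split; [|assumption].
    destruct k as [|k]; [auto|right]; apply NNPP; intros Hc.
    enough (S k <= k) by lia; apply Hmin; intros s.
    destruct (crosses s n l (S k)) eqn:Ec; [elim Hc; eauto|reflexivity].
  - unfold cut_bit; rewrite E2; intros Exy; apply HN.
    assert (Hin : In y l); [|now apply Hx in Hin].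
    apply mem_In; rewrite <- Exy; apply mem_In, Hx; split; [lia|reflexivity].
  - pose proof (cpair_ge (cpair n j) k); pose proof (cpair_ge n j); lia.
Qed.
End NormalForm.

Lemma Sigma03_normal_form E : Equivalence E -> Sigma03 E ->
  exists bit On, Comp (fun p => bit (fst p) (snd p)) /\ Comp (fun p => On (fst p) (snd p)) /\
    (forall t, exists s, persistent On s t) /\
    forall x y, E x y <-> exists b, forall t, differ bit On x y t -> t < b.
Proof.
  intros HE (A & HA & HEA).
  destruct (computable_set_Comp A HA) as (a & Ca & Ha).
  assert (E_iff : forall x y, E x y <->
    exists i, forall b, exists c, a (cpair (cpair x y) (cpair i (cpair b c))) = true).
  { intros x y; rewrite HEA; split; intros [i Hi]; exists i; intros b;
      destruct (Hi b) as [c Hc]; exists c; now apply Ha. }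
  exists cut_bit, (live a); repeat split.
  - apply Comp_cut_bit.
  - now apply Comp_live.
  - apply live_cv.
  - now apply related_bounded.
  - intros [b Hb]; apply NNPP; intros HN.
    destruct (unrelated_unbounded E HE a E_iff x y b HN) as (t & Ht & Hle).
    apply Hb in Ht; lia.
Qed.

(** * Universality *)

Theorem theorem3p15 (G : computable_subgroup_Sinf) :
  non_isolated G -> Sigma03_universal (Rce G).
Proof.
  intros HG E HE HS.
  destruct (computable_set_Comp _ (dom_computable G)) as (inG & CinG & HinG).
  pose proof (computable2_Comp _ (mul_computable G)) as Cmul.
  pose proof (computable2_Comp _ (act_computable G)) as Cact.
  (* Numbers outside the domain are read as the identity, so that all operations become total. *)
  pose (nrm g := if inG g then g else one G).
  assert (Cnrm : Comp nrm) by (unfold nrm; comp).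
  assert (Hnrm : forall g, dom G (nrm g)).
  { intros g; unfold nrm; destruct (inG g) eqn:Eg; [now apply HinG|apply one_dom]. }
  assert (nrm_id : forall g, dom G g -> nrm g = g).
  { intros g Hg; unfold nrm; apply HinG in Hg; now rewrite Hg. }
  pose (act' g x := act G (nrm g) x).
  pose (mul' g h := mul G (nrm g) (nrm h)).
  assert (Cact' : Comp (fun p => act' (fst p) (snd p))) by (unfold act'; comp).
  assert (Cmul' : Comp (fun p => mul' (fst p) (snd p))) by (unfold mul'; comp).
  assert (act'_one : forall x, act' (one G) x = x).
  { intros x; unfold act'; rewrite nrm_id by apply one_dom; apply act_one. }
  assert (act'_mul : forall g h x, act' (mul' g h) x = act' g (act' h x)).
  { intros g h x; unfold act', mul'; rewrite nrm_id by (apply mul_dom; auto).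
    now apply act_mul. }
  destruct (Comp_search (fun g h => inG h && ((mul G h (nrm g) =? one G) && (mul G (nrm g) h =? one G))))
    as (inv & Cinv & Hinv); [comp| |].
  { intros g; destruct (mul_inv G (nrm g) (Hnrm g)) as (h & Hh & H1 & H2).
    exists h; apply HinG in Hh; rewrite Hh, H1, H2, Nat.eqb_refl; reflexivity. }
  assert (Hinv' : forall g x, act' (inv g) (act' g x) = x /\ act' g (act' (inv g) x) = x).
  { intros g x; specialize (Hinv g).
    apply andb_true_iff in Hinv as [H1 H2]; apply andb_true_iff in H2 as [H2 H3].
    apply HinG in H1; apply Nat.eqb_eq in H2, H3.
    unfold act'; rewrite (nrm_id _ H1), <- !act_mul, H2, H3 by auto; auto using act_one. }
  pose proof (act_inj act' inv (fun g x => proj1 (Hinv' g x))) as act'_inj.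
  assert (Hmove : forall F, exists g q, (forall x, In x F -> act' g x = x) /\ act' g q <> q).
  (* If every element fixing [F] acted trivially, [F] would witness isolation. *)
  { intros F; apply NNPP; intros HN; apply HG; exists F; intros g; split.
    - intros [Hg Hfix]; split; auto; intros q; apply NNPP; intros Hq; apply HN.
      exists g, q; unfold act'; rewrite nrm_id; auto.
    - intros [Hg Hfix]; split; auto. }
  destruct (Comp_search (fun (p : nat * (nat * list nat)) n =>
      forallb (fun x => act' (fst (Cantor.of_nat n)) x =? x) (snd (snd p)) &&
      (negb (mem (snd (Cantor.of_nat n)) (snd (snd p))) &&
       negb (act' (fst p) (act' (fst (Cantor.of_nat n)) (snd (Cantor.of_nat n)))
             =? act' (fst (snd p)) (snd (Cantor.of_nat n)))))) as (find & Cfind & Hfind);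
    [comp| |].
  { intros (k & d & F).
    assert (Hgq : exists g q, (forall x, In x F -> act' g x = x) /\ ~ In q F /\
              act' k (act' g q) <> act' d q).
    (* If [k] and [d] disagree outside [F], the identity suffices. Otherwise some [g] fixing [F]
       moves a point [q]; both [q] and its image lie outside [F], so [k] agrees with [d] at the
       image, and [d] is injective. *)
    { destruct (classic (exists q, ~ In q F /\ act' k q <> act' d q)) as [(q & Hq & Hne)|HN].
      - exists (one G), q; rewrite act'_one; auto.
      - destruct (Hmove F) as (g & q & Hfix & Hq).
        assert (Hout : ~ In q F) by (intros Hi; apply Hq; auto).
        assert (Hout' : ~ In (act' g q) F).
        { intros Hi; apply Hq, (act'_inj g); auto. }
        exists g, q; repeat split; auto; intros Eq.
        assert (Ekd : act' k (act' g q) = act' d (act' g q))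
          by (apply NNPP; intros Hne; apply HN; eauto).
        apply Hq, (act'_inj d); congruence. }
    destruct Hgq as (g & q & Hfix & Hq & Hne).
    exists (cpair g q); rewrite of_nat_cpair; cbn [fst snd].
    repeat (apply andb_true_iff; split).
    - apply forallb_forall; intros x Hx; apply Nat.eqb_eq; auto.
    - apply negb_true_iff, not_true_iff_false; now rewrite mem_In.
    - apply negb_true_iff, Nat.eqb_neq; auto. }
  destruct (Sigma03_normal_form E HE HS) as (bit & On & Cbit & COn & On_cv & HEd).
  assert (Hfind' : forall k d F, let w := Cantor.of_nat (find (k, (d, F))) in
    (forall x, In x F -> act' (fst w) x = x) /\ ~ In (snd w) F /\
    act' k (act' (fst w) (snd w)) <> act' d (snd w)).
  { intros k d F w; specialize (Hfind (k, (d, F))); cbn [fst snd] in Hfind; fold w in Hfind.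
    apply andb_true_iff in Hfind as [H1 H2]; apply andb_true_iff in H2 as [H2 H3].
    repeat split.
    - intros x Hx; eapply forallb_forall in H1; [|exact Hx]; now apply Nat.eqb_eq.
    - apply negb_true_iff, not_true_iff_false in H2; now rewrite mem_In in H2.
    - now apply Nat.eqb_neq, negb_true_iff. }
  destruct (family_exists act' mul' inv (one G) act'_one act'_mul
    (fun g x => proj1 (Hinv' g x)) (fun g x => proj2 (Hinv' g x))
    (fun p => Cantor.of_nat (find p))
    (fun k d F => proj1 (Hfind' k d F)) (fun k d F => proj1 (proj2 (Hfind' k d F)))
    (fun k d F => proj2 (proj2 (Hfind' k d F))) bit On On_cv Cact' Cmul' Cinv ltac:(comp)
    Cbit COn) as (f & Cf & Hf).
  exists f; split; [assumption|]; intros x y.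
  rewrite HEd, <- Hf; unfold Rce; split.
  (* Any number acts as its normalisation, which lies in the domain. *)
  - intros [g Hg]; exists (nrm g); split; auto.
  - intros (g & Hg & H); exists g; unfold act'; now rewrite nrm_id.
Qed.
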